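(* Let $f:R_{1}\rightarrow R_{2}$ be a homomorphism of commutative rings with identity, $J$ an ideal of $R_{2}$, $M_{1}$ an $R_{1}$-module, $M_{2}$ an $R_{2}$-module (regarded as an $R_1$-module via $f$) and $\varphi:M_{1}\rightarrow M_{2}$ an $R_{1}$-module homomorphism. Consider the $(R_{1}\Join^{f}J)$-module $M_{1}\Join^{\varphi}JM_{2}$ and let $N_{1}$ be a proper submodule of $M_{1}$. If $N_{1}\Join^{\varphi}JM_{2}$ is an $n$-submodule of $M_{1}\Join^{\varphi}JM_{2}$, then $N_{1}$ is an $n$-submodule of $M_{1}$. Moreover, the converse is true if $JM_{2}=\{0_{M_{2}}\}$.
   Context: Modules are unital. $R_{1}\Join^{f}J=\{(r,f(r)+j): r\in R_1, j\in J\}$ is a subring of $R_1\times R_2$ (the amalgamation of $R_1$ and $R_2$ along $J$ with respect to $f$). $M_{1}\Join^{\varphi}JM_{2}=\{(m_1,\varphi(m_1)+m_2): m_1\in M_1, m_2\in JM_2\}$ is an $(R_1\Join^f J)$-module with scalar product $(r,f(r)+j)(m_1,\varphi(m_1)+m_2)=(rm_1,\varphi(rm_1)+f(r)m_2+j\varphi(m_1)+jm_2)$. For a submodule $N_1$ of $M_1$, $N_{1}\Join^{\varphi}JM_{2}=\{(m_1,\varphi(m_1)+m_2)\in M_1\Join^{\varphi}JM_2: m_1\in N_1\}$, a submodule of $M_{1}\Join^{\varphi}JM_{2}$. For a commutative ring $A$ and an $A$-module $X$, a proper submodule $Y$ of $X$ is an $n$-submodule if whenever $a\in A$, $x\in X$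 with $ax\in Y$ and $a\notin\sqrt{Ann_A(X)}$, then $x\in Y$, where $Ann_A(X)=\{a\in A: aX=0\}$. *)

(* Defs.v *)
From HB Require Import structures.
From mathcomp Require Import all_boot all_algebra boolp.

Set Implicit Arguments.
Unset Strict Implicit.
Unset Printing Implicit Defensive.

Import GRing.Theory.
Local Open Scope ring_scope.

(* The zero ring is allowed, hence comPzRingType. Ideals of R are the
   submodules of the regular module R^o, improper ones included. Submodules are
   MathComp's bool-valued submodClosed predicates; since `[< _ >] reflects every
   proposition, this is no restriction to decidable submodules. *)

Section NSubmodule.
Variables (A : comPzRingType) (X : lmodType A).

Definition ann (a : A) : Prop := forall x : X, a *: x = 0.

Definition radical (I : A -> Prop) (a : A) : Prop :=
  exists2 k : nat, (0 < k)%N & I (a ^+ k).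

Definition proper_submodule (Y : submodClosed X) : Prop :=
  exists x : X, x \notin Y.

Definition n_submodule (Y : submodClosed X) : Prop :=
  proper_submodule Y /\
  forall (a : A) (x : X), a *: x \in Y -> ~ radical ann a -> x \in Y.

End NSubmodule.

Section IdealSmul.
Variables (R : comPzRingType) (J : submodClosed R^o) (M : lmodType R).

Definition ideal_smul : {pred M} := fun x =>
  `[< exists2 s : seq (R * M), {in s, forall p, p.1 \in J}
        & x = \sum_(p <- s) p.1 *: p.2 >].

Fact ideal_smul_closed : submod_closed ideal_smul.
Proof.
split; first by apply/asboolP; exists [::] => //; rewrite big_nil.
move=> a x y /asboolP[s sJ ->] /asboolP[t tJ ->]; apply/asboolP.
exists ([seq (a * p.1, p.2) | p <- s] ++ t).
  move=> p; rewrite mem_cat => /orP[/mapP[q qs ->]|/tJ //].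
  exact: (@rpredZ _ _ J a (q.1 : R^o) (sJ q qs)).
rewrite big_cat big_map scaler_sumr; congr (_ + _).
by apply: eq_bigr => p _; rewrite scalerA.
Qed.

HB.instance Definition _ :=
  GRing.isSubmodClosed.Build R M ideal_smul ideal_smul_closed.

Lemma ideal_smulP j m : j \in J -> j *: m \in ideal_smul.
Proof.
by move=> jJ; apply/asboolP; exists [:: (j, m)];
  rewrite ?big_seq1 // => p; rewrite inE => /eqP->.
Qed.

End IdealSmul.

Arguments ideal_smul {R} J M _.

Section AmalgRing.
Variables (R1 R2 : comPzRingType) (f : {rmorphism R1 -> R2}).
Variable J : submodClosed R2^o.

Definition amalg_pred : {pred R1 * R2} := fun x =>
  `[< exists (r : R1) (j : R2), j \in J /\ x = (r, f r + j) >].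

Lemma amalg_predE x : (x \in amalg_pred) = ((x.2 - f x.1 : R2) \in J).
Proof.
apply/asboolP/idP => [[r [j [jJ ->]]] /=|xJ]; first by rewrite addrC addKr.
by exists x.1, (x.2 - f x.1); split=> //; case: x {xJ} => a b /=; rewrite addrC subrK.
Qed.

Fact amalg_closed : subring_closed amalg_pred.
Proof.
split=> [|x y|x y]; rewrite !amalg_predE /=.
- by rewrite rmorph1 subrr (rpred0 J).
- move=> xJ yJ; rewrite rmorphB.
  have -> : x.2 - y.2 - (f x.1 - f y.1) = (x.2 - f x.1) - (y.2 - f y.1).
    by rewrite !opprD addrACA.
  exact: (GRing.submod_closedB (submodClosedP J)).2.
move=> xJ yJ; rewrite rmorphM.
have -> : x.2 * y.2 - f x.1 * f y.1 =
    y.2 * (x.2 - f x.1) + f x.1 * (y.2 - f y.1).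
  by rewrite !mulrBr addrA (mulrC y.2 (f _)) subrK mulrC.
exact: (@rpredD _ J (y.2 * _ : R2) (f x.1 * _ : R2)
  (@rpredZ _ _ J y.2 _ xJ) (@rpredZ _ _ J (f x.1) _ yJ)).
Qed.

HB.instance Definition _ :=
  GRing.isSubringClosed.Build (R1 * R2)%type amalg_pred amalg_closed.

Definition amalg : Type := {x : R1 * R2 | x \in amalg_pred}.

HB.instance Definition _ := SubChoice.on amalg.
HB.instance Definition _ :=
  GRing.SubChoice_isSubComPzRing.Build (R1 * R2)%type amalg_pred amalg
    amalg_closed.

End AmalgRing.

Section AmalgModule.
Variables (R1 R2 : comPzRingType) (f : {rmorphism R1 -> R2}).
Variable J : submodClosed R2^o.
Variables (M1 : lmodType R1) (M2 : lmodType R2).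
(* additive with phi (r *: m) = f r *: phi m *)
Variable phi : {linear M1 -> M2 | f \; *:%R}.

Definition amalg_mod_pred : {pred M1 * M2} := fun x =>
  `[< exists (m1 : M1) (m2 : M2), m2 \in ideal_smul J M2 /\ x = (m1, phi m1 + m2) >].

Lemma amalg_mod_predE x :
  (x \in amalg_mod_pred) = (x.2 - phi x.1 \in ideal_smul J M2).
Proof.
apply/asboolP/idP => [[r [j [jJ ->]]] /=|xJ]; first by rewrite addrC addKr.
by exists x.1, (x.2 - phi x.1); split=> //; case: x {xJ} => a b /=; rewrite addrC subrK.
Qed.

Fact amalg_mod_closed : zmod_closed amalg_mod_pred.
Proof.
split=> [|x y]; rewrite !amalg_mod_predE /=; first by rewrite linear0 subrr rpred0.
move=> xJ yJ; rewrite linearB.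
have -> : x.2 - y.2 - (phi x.1 - phi y.1) = (x.2 - phi x.1) - (y.2 - phi y.1).
  by rewrite !opprD addrACA.
exact: (GRing.submod_closedB (submodClosedP (ideal_smul J M2))).2.
Qed.

HB.instance Definition _ :=
  GRing.isZmodClosed.Build (M1 * M2)%type amalg_mod_pred amalg_mod_closed.

Definition amalg_mod : Type := {x : M1 * M2 | x \in amalg_mod_pred}.

HB.instance Definition _ := SubChoice.on amalg_mod.
HB.instance Definition _ :=
  GRing.SubChoice_isSubZmodule.Build (M1 * M2)%type amalg_mod_pred amalg_mod
    amalg_mod_closed.

(* (r, f r + j) (m1, phi m1 + m2)
     = (r m1, phi (r m1) + f r m2 + j phi m1 + j m2) *)
Definition amalg_scale_val (a : R1 * R2) (x : M1 * M2) : M1 * M2 :=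
  let r := a.1 in let j := a.2 - f a.1 in
  let m1 := x.1 in let m2 := x.2 - phi x.1 in
  (r *: m1, phi (r *: m1) + f r *: m2 + j *: phi m1 + j *: m2).

Lemma amalg_scale_valE a x : amalg_scale_val a x = (a.1 *: x.1, a.2 *: x.2).
Proof.
rewrite /amalg_scale_val linearZ_LR /= -scalerDr [phi _ + _]addrC subrK.
by rewrite -addrA -scalerDr [phi _ + _]addrC subrK -scalerDl addrC subrK.
Qed.

Fact amalg_scale_subproof (a : amalg f J) (x : amalg_mod) :
  amalg_scale_val (val a) (val x) \in amalg_mod_pred.
Proof.
have := valP a; have := valP x; rewrite amalg_predE !amalg_mod_predE.
move=> xJ aJ; rewrite /amalg_scale_val /=.
rewrite -!addrA addrC -!addrA addNr addr0.
by apply: rpredD; [exact: rpredZ | apply: rpredD; [exact: ideal_smulP | exact: rpredZ]].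
Qed.

Definition amalg_scale (a : amalg f J) (x : amalg_mod) : amalg_mod :=
  Sub (amalg_scale_val (val a) (val x)) (amalg_scale_subproof a x).

Fact amalg_scaleA a b x :
  amalg_scale a (amalg_scale b x) = amalg_scale (a * b) x.
Proof. by apply/val_inj; rewrite /= !amalg_scale_valE /= !scalerA. Qed.

Fact amalg_scale1 : left_id 1 amalg_scale.
Proof.
by move=> x; apply/val_inj; rewrite /= amalg_scale_valE /= !scale1r; case: (val x).
Qed.

Fact amalg_scaleDr : right_distributive amalg_scale +%R.
Proof.
by move=> a x y; apply/val_inj; rewrite /= !amalg_scale_valE /= !scalerDr.
Qed.

Fact amalg_scaleDl x : {morph amalg_scale^~ x : a b / a + b}.
Proof.
by move=> a b; apply/val_inj; rewrite /= !amalg_scale_valE /= !scalerDl.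
Qed.

HB.instance Definition _ := GRing.Zmodule_isLmodule.Build (amalg f J) amalg_mod
  amalg_scaleA amalg_scale1 amalg_scaleDr amalg_scaleDl.

Variable N1 : submodClosed M1.

Definition amalg_submod : {pred amalg_mod} := fun x => (val x).1 \in N1.

Fact amalg_submod_closed : submod_closed amalg_submod.
Proof.
split=> [|a x y]; rewrite -!topredE /= /amalg_submod; first exact: (rpred0 N1).
by move=> xN yN; apply: rpredD; first exact: rpredZ.
Qed.

HB.instance Definition _ := GRing.isSubmodClosed.Build (amalg f J) amalg_mod
  amalg_submod amalg_submod_closed.

End AmalgModule.

Arguments amalg_mod {R1 R2 f} J {M1 M2} phi.
Arguments amalg_submod {R1 R2 f} J {M1 M2} phi N1 _.

(* Main.v *)
(* Both directions compare first coordinates: elements of M1 and R1 lift along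
   the graphs of phi and f, which gives the forward implication. When J M2 = 0
   every element of the amalgamated module lies on the graph of phi, so an
   element of the amalgamated ring kills that module as soon as its first
   coordinate kills M1. *)
Require Import Defs.
From mathcomp Require Import all_boot all_algebra.

Local Open Scope ring_scope.

Import GRing.Theory.

Section Amalgamation.
Set Implicit Arguments.
Unset Strict Implicit.
Variables (R1 R2 : comPzRingType) (f : {rmorphism R1 -> R2}).
Variable J : submodClosed R2^o.
Variables (M1 : lmodType R1) (M2 : lmodType R2).
Variable phi : {linear M1 -> M2 | f \; *:%R}.

Fact amalg_graph_subproof (r : R1) : (r, f r) \in amalg_pred f J.
Proof. by rewrite amalg_predE /= subrr (rpred0 J). Qed.

Definition amalg_graph (r : R1) : amalg f J := Sub (r, f r) (amalg_graph_subproof r).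

Fact amalg_mod_graph_subproof (m : M1) : (m, phi m) \in amalg_mod_pred J phi.
Proof. by rewrite amalg_mod_predE /= subrr rpred0. Qed.

Definition amalg_mod_graph (m : M1) : amalg_mod J phi :=
  Sub (m, phi m) (amalg_mod_graph_subproof m).

Lemma val_scale_fst (a : amalg f J) (x : amalg_mod J phi) :
  (val (a *: x)).1 = (val a).1 *: (val x).1.
Proof. by []. Qed.

Lemma val_exp_fst (a : amalg f J) k : (val (a ^+ k)).1 = (val a).1 ^+ k.
Proof. by rewrite rmorphXn /= (rmorphXn fst). Qed.

(** A power of [a] killing the whole module kills each [(m, phi m)] in particular, and the first
    coordinate of that equation is the claim. No condition on [J] enters. *)
Lemma radical_ann_fst (a : amalg f J) :
  radical (ann (amalg_mod J phi)) a -> radical (ann M1) (val a).1.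
Proof.
case=> k k_gt0 annak; exists k => // m.
have /(congr1 (fun x => (val x).1)) := annak (amalg_mod_graph m).
by rewrite val_scale_fst val_exp_fst.
Qed.

(** The second coordinate differs from [phi] of the first by an element of $JM_2 = 0$, so the first
    coordinate determines [x]. *)
Lemma amalg_mod_eq0 (x : amalg_mod J phi) :
  ideal_smul J M2 =i pred1 (0 : M2) -> (val x).1 = 0 -> x = 0.
Proof.
move=> JM20 x10; apply/val_inj; have := valP x.
rewrite amalg_mod_predE JM20 inE x10 linear0 subr0 => /eqP x20.
by apply/eqP; rewrite -pair_eqE /= x10 x20 !eqxx.
Qed.

(** Converse of [radical_ann_fst] when $JM_2 = 0$; the same exponent [k] serves. *)
Lemma radical_ann_amalg (a : amalg f J) :
  ideal_smul J M2 =i pred1 (0 : M2) ->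
  radical (ann M1) (val a).1 -> radical (ann (amalg_mod J phi)) a.
Proof.
move=> JM20 [k k_gt0 annak]; exists k => // x; apply: amalg_mod_eq0 => //.
by rewrite val_scale_fst val_exp_fst annak.
Qed.

Lemma mem_amalg_submod (N1 : submodClosed M1) (x : amalg_mod J phi) :
  (x \in amalg_submod J phi N1) = ((val x).1 \in N1).
Proof. by []. Qed.

End Amalgamation.

Theorem theorem8 (R1 R2 : comPzRingType) (f : {rmorphism R1 -> R2})
    (J : submodClosed R2^o) (M1 : lmodType R1) (M2 : lmodType R2)
    (phi : {linear M1 -> M2 | f \; *:%R}) (N1 : submodClosed M1)
    (N1_proper : proper_submodule N1) :
  (n_submodule (amalg_submod J phi N1) -> n_submodule N1) /\
  (ideal_smul J M2 =i pred1 (0 : M2) ->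
     n_submodule N1 -> n_submodule (amalg_submod J phi N1)).
Proof.
split=> [[_ nN]|JM20 [_ nN]]; split=> //.
- move=> r m rmN nrad.
  have := nN (amalg_graph f J r) (amalg_mod_graph J phi m).
  (* The first coordinate of the product of the two lifts is [r *: m] by computation, so [rmN]
     settles the membership premise. *)
  rewrite !mem_amalg_submod; apply=> // rad.
  exact: nrad (radical_ann_fst rad).
(* Properness: the lift of an element outside [N1] stays outside. *)
- by case: N1_proper => m mN; exists (amalg_mod_graph J phi m).
- move=> a x; rewrite !mem_amalg_submod val_scale_fst => axN nrad.
  apply: nN axN _ => rad.
  exact: nrad (radical_ann_amalg phi JM20 rad).
Qed.
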